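(* For every cache size $k\ge1$, there is a randomized online paging algorithm for the discard-predictions setup that is $(1,2H_k,1)$-competitive, where $H_k=\sum_{j=1}^k 1/j$. That is, there is a constant $b$ (possibly depending on $k$) such that for every request sequence $I$ and every prediction vector $p$, the expected number of page faults satisfies $\mathbb{E}[\mathrm{ALG}(I,p)]\le \mathrm{OPT}(I)+2H_k\,\eta_0(p,p^* )+\eta_1(p,p^* )+b$.
   Context: Paging: there is a universe $U$ of pages and a cache holding at most $k$ pages, initially empty. Requests $r_1,\dots,r_n\in U$ arrive online. If the requested page is not in the cache (a page fault), it must be loaded into the cache, evicting some cached page if the cache already holds $k$ pages. The cost of an algorithm is its number of page faults. An online algorithm decides evictions without knowing future requests; $\mathrm{OPT}(I)$ is the minimum cost of an offline algorithm on request sequence $I$. Along with each request $r_i$ the online algorithm receives a prediction bit $p_i\in\{0,1\}$ (which may be arbitrary). Given the ground truth vector $p^*\in\{0,1\}^n$, define for $h\in\{0,1\}$: $\eta_h(p,p^* )=|\{i\in[n] : p_i=h,\ p_i^*=1-h\}|$. An algorithm is $(\alpha,\beta,\gamma)$-competitive if there is a constant $b$ (possibly depending on $k$) such that for every instance $I$ and all predictions $p$, $\mathrm{ALG}(I,p)\le \alpha\,\mathrm{OPT}(I)+\beta\,\eta_0(p,p^* )+\gamma\,\eta_1(p,p^* )+b$ (for randomized algorithms, $\mathrm{ALG}(I,p)$ is the expected cost). Discard-predictions setup: fix the optimal offline algorithm LFD, which on a fault with full cache evicts a cached page that is never requested again if one exists, and otherwise the cached page whose next request is furthest in the future (ties broken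 by a fixed rule). The ground truth is $p_i^*=0$ if LFD keeps page $r_i$ in its cache until the next request to $r_i$ (or until the end of the sequence if there is no further request), and $p_i^*=1$ if LFD evicts $r_i$ before it is requested again. *)

(* Defs.v *)
From Stdlib Require List.
From HB Require Import structures.
From mathcomp Require Import all_boot all_order all_algebra.
From mathcomp Require Import reals.
Set Implicit Arguments. Unset Strict Implicit. Unset Printing Implicit Defensive.
Import Order.TTheory GRing.Theory Num.Theory.

Section Paging.
Variable U : eqType.

Definition step_ok (k : nat) (r : U) (C C' : seq U) : Prop :=
  if r \in C then C' = C
  else if size C < k then C' = r :: C
  else exists2 x, x \in C & C' = r :: rem x C.

Fixpoint traj_ok (k : nat) (C : seq U) (I : seq U) (cs : seq (seq U)) : Prop :=
  match I, cs with
  | [::], [::] => True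
  | r :: I', C' :: cs' => step_ok k r C C' /\ traj_ok k C' I' cs'
  | _, _ => False
  end.

Fixpoint traj_cost (C : seq U) (I : seq U) (cs : seq (seq U)) : nat :=
  match I, cs with
  | r :: I', C' :: cs' => (r \notin C) + traj_cost C' I' cs'
  | _, _ => 0
  end.

(** Offline (deterministic, full-knowledge) algorithms on instance [I]:
    any valid cache trajectory starting from the empty cache. *)
Definition offline_ok (k : nat) (I : seq U) (cs : seq (seq U)) : Prop :=
  traj_ok k [::] I cs.
Definition offline_cost (I : seq U) (cs : seq (seq U)) : nat :=
  traj_cost [::] I cs.

(** An LFD eviction rule [ev I i C] (instance, index of current request,
    current cache): on a fault with full cache at request [r] (with [pre] the
    earlier requests and [suf] the later ones), it evicts a cached page never
    requested again if one exists, and otherwise the cached page whose next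
    request is furthest in the future.  Ties are broken by the (arbitrary,
    fixed, deterministic) rule [ev]. *)
Definition is_LFD (k : nat) (ev : seq U -> nat -> seq U -> U) : Prop :=
  forall (pre : seq U) (r : U) (suf : seq U) (C : seq U),
    uniq C -> size C = k -> r \notin C ->
    let x := ev (pre ++ r :: suf) (size pre) C in
    x \in C /\
    (x \notin suf \/
     ((forall y, y \in C -> y \in suf) /\
      (forall y, y \in C -> index y suf <= index x suf))).

Fixpoint lfd_from (k : nat) (ev : seq U -> nat -> seq U -> U) (I0 : seq U)
    (i : nat) (C : seq U) (I : seq U) : seq (seq U) :=
  match I with
  | [::] => [::]
  | r :: I' =>
      let C' := if r \in C then C
                else if size C < k then r :: C
                else r :: rem (ev I0 i C) C in
      C' :: lfd_from k ev I0 i.+1 C' I'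
  end.

Definition lfd_traj k ev (I : seq U) := lfd_from k ev I 0 [::] I.

(** Ground truth: [pstar_i = 1] iff LFD evicts [r_i] before its next request (or
    before the end of the sequence if there is none).  [ds] lists the caches
    after requests i, i+1, ...; page [r_i] is kept iff it is in the caches
    after requests i, ..., t-1 where t is the next request to r_i (or n). *)
Fixpoint pstar_aux (I : seq U) (ds : seq (seq U)) : seq bool :=
  match I, ds with
  | r :: I', _ :: ds' =>
      (~~ all (fun D => r \in D) (take (index r I').+1 ds)) :: pstar_aux I' ds'
  | _, _ => [::]
  end.

Definition pstar k ev (I : seq U) : seq bool := pstar_aux I (lfd_traj k ev I).

End Paging.

Definition pred_err (h : bool) (p ps : seq bool) : nat :=
  count (fun q => (q.1 == h) && (q.2 == ~~ h)) (zip p ps).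

(** Randomized online paging algorithms: a (behavioural) randomized state
    machine.  On each request [r] with prediction [b], from state [s] it moves
    to a random next state according to a finitely supported distribution
    [rstep s r b] (list of (probability, state)).  [rcache s] is the cache in
    state [s].  The algorithm only sees past and current requests/predictions. *)
Record ralg (U : eqType) (R : realType) := RAlg {
  rstate : Type;
  rinit : rstate;
  rcache : rstate -> seq U;
  rstep : rstate -> U -> bool -> seq (R * rstate)
}.

Definition ralg_ok (U : eqType) (R : realType) (k : nat) (A : ralg U R) : Prop :=
  rcache (rinit A) = [::] /\
  forall (s : rstate A) (r : U) (b : bool),
    (\sum_(q <- rstep s r b) q.1 = 1)%R /\
    (forall q, List.In q (rstep s r b) ->
       (0 <= q.1)%R /\ step_ok k r (rcache s) (rcache q.2)).

Fixpoint ecost_from (U : eqType) (R : realType) (A : ralg U R)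
    (s : rstate A) (rs : seq (U * bool)) : R :=
  match rs with
  | [::] => 0%R
  | (r, b) :: rs' =>
      ((r \notin rcache s)%:R +
       \sum_(q <- rstep s r b) q.1 * ecost_from q.2 rs')%R
  end.

Definition ecost (U : eqType) (R : realType) (A : ralg U R) (I : seq U)
    (p : seq bool) : R := ecost_from (rinit A) (zip I p).

Definition harmonic (R : realType) (k : nat) : R :=
  (\sum_(1 <= j < k.+1) (j%:R)^-1)%R.

(* Main.v *)
Require Import Defs.
From HB Require Import structures.
From mathcomp Require Import all_boot all_order all_algebra.
From mathcomp Require Import reals.
From mathcomp Require Import zify lra.
Import Order.TTheory GRing.Theory Num.Theory.
Set Implicit Arguments.
Unset Strict Implicit.
Unset Printing Implicit Defensive.

(** The algorithm keeps a virtual cache, contained in the real one, of pages whose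
    last prediction is 0.  A phase starts with [k] such pages, the old ones; each
    request leaves the old pages and, if predicted 0, marks the page.  When room
    is needed another random unmarked old page is dropped; when [k] pages are
    marked and another page is requested, the marked pages become the old pages
    of a new phase.

    After [d] drops, the marked and the old pages together with the requested
    page were once [k + d] pages, at most [k] of which LFD can hold, so [d] of
    them were wrongly predicted 0, and this within the last two phases.  Hence
    the next request to one of [j] old pages misses with probability at most
    [d / j], and each wrong 0-prediction accounts for [H_k] expected misses in
    either of two phases.  All other misses are on pages that LFD also misses,
    on pages wrongly predicted 1, or on the at most [d] old pages left over at
    the end of a phase, which the unused part of [d * H_k] pays for.  Finally
    LFD is optimal. *)

(** * Optimality of LFD *)

Section Offline.
Variables (U : eqType) (k : nat).
Implicit Types (C D I : seq U) (r x : U).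

Lemma step_ok_inv r C C' :
  0 < k -> step_ok k r C C' -> uniq C -> size C <= k ->
  [/\ uniq C', size C' <= k, r \in C' & {subset C' <= r :: C}].
Proof.
rewrite /step_ok => k0; case: ifPn => [rC -> uC sC|rC].
  by split => // y yC; rewrite inE yC orbT.
case: ifP => [sC -> uC _|_ [x xC ->] uC sC].
  by split => //=; rewrite ?mem_head // rC.
have rrem : r \notin rem x C by apply: contra rC; apply: mem_rem.
split => [|||y]; rewrite ?mem_head //=.
- by rewrite rrem rem_uniq.
- by rewrite size_rem //; case: (C) xC sC.
- by rewrite !inE; case: eqP => //= _; apply: mem_rem.
Qed.

(** [index] returns [size I] for an absent page, so for [t <= size I] only pages that are requested
    again count. *)
Definition soon t I C := count (fun x => index x I < t) C.

Lemma soon0 I C : soon 0 I C = 0.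
Proof. by rewrite /soon (@eq_count _ _ pred0) ?count_pred0. Qed.

Lemma soonS_notin t r I C : r \notin C -> soon t.+1 (r :: I) C = soon t I C.
Proof.
move=> rC; apply: eq_in_count => x xC /=.
by case: eqP rC => [->|_ _]; rewrite ?xC.
Qed.

Lemma soon_rem t I x C : x \in C ->
  soon t I C = (index x I < t) + soon t I (rem x C).
Proof. by move=> xC; rewrite /soon (permP (perm_to_rem xC)). Qed.

Lemma soonS_in t r I C : r \in C -> uniq C ->
  soon t.+1 (r :: I) C = (soon t I (rem r C)).+1.
Proof.
move=> rC uC; rewrite (soon_rem _ _ rC) /= eqxx.
by rewrite soonS_notin // mem_rem_uniqF.
Qed.

Lemma soon_cons t I x C : soon t I (x :: C) = (index x I < t) + soon t I C.
Proof. by []. Qed.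

Lemma soon_le_size t I C : soon t I C <= size C.
Proof. exact: count_size. Qed.

Lemma lfd_step_ok (ev : seq U -> nat -> seq U -> U) pre r I C :
  is_LFD k ev -> uniq C -> size C <= k ->
  step_ok k r C (if r \in C then C else if size C < k then r :: C
                 else r :: rem (ev (pre ++ r :: I) (size pre) C) C).
Proof.
move=> LFD uC sC; rewrite /step_ok; case rC: (r \in C) => //.
case: (ltnP (size C) k) => // kC.
have [|xC _] := LFD pre r I C uC _ (negbT rC); first lia.
by exists (ev (pre ++ r :: I) (size pre) C).
Qed.

Lemma lfd_from_ok (ev : seq U -> nat -> seq U -> U) pre I C :
  0 < k -> is_LFD k ev -> uniq C -> size C <= k ->
  traj_ok k C I (lfd_from k ev (pre ++ I) (size pre) C I).
Proof.
move=> k0 LFD; elim: I pre C => //= r I IH pre C uC sC.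
have st := lfd_step_ok pre r I LFD uC sC; split=> //.
have [uC' sC' _ _] := step_ok_inv k0 st uC sC.
move: (if _ then _ else _) uC' sC' => C' uC' sC'.
by rewrite -cat_rcons -(size_rcons pre r); apply: IH.
Qed.

(* Induction on the requests, with a slack [m] bounding how many more pages
   due within any horizon the competitor holds than LFD does. *)
Lemma lfd_from_optimal (ev : seq U -> nat -> seq U -> U) pre I C D cs m :
  0 < k -> is_LFD k ev -> uniq C -> size C <= k -> uniq D -> size D <= k ->
  traj_ok k D I cs ->
  (forall t, t <= size I -> soon t I D <= soon t I C + m) ->
  traj_cost C I (lfd_from k ev (pre ++ I) (size pre) C I)
    <= traj_cost D I cs + m.
Proof.
move=> k0 LFD; elim: I pre C D cs m => //= r I IH pre C D [//|D' cs] m.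
move=> uC sC uD sD [stD trD] le_m.
have stC := lfd_step_ok pre r I LFD uC sC.
have [uC' sC' _ _] := step_ok_inv k0 stC uC sC.
have [uD' sD' _ _] := step_ok_inv k0 stD uD sD.
move: stC uC' sC'; set C' := (if r \in C then _ else _) => stC uC' sC'.
(* A miss of the competitor raises the slack and a miss of LFD lowers it; by [rm] the truncated
   subtraction is exact. *)
set m' := (r \notin D) + m - (r \notin C).
have rm : (r \notin C) <= (r \notin D) + m.
  case rC: (r \in C) => //=; case rD: (r \in D) => //=.
  have := le_m 1 isT; rewrite (soonS_in _ _ rD uD) soonS_notin ?rC //.
  by rewrite !soon0; lia.
suff : traj_cost C' I (lfd_from k ev (pre ++ r :: I) (size pre).+1 C' I)
         <= traj_cost D' I cs + m' by lia.
rewrite -cat_rcons -(size_rcons pre r); apply: IH => // t tI.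
have {le_m} := le_m t.+1 tI.
have leD : soon t I D' <= (index r I < t) +
    (if r \in D then soon t I (rem r D) else soon t I D).
  move: stD; rewrite /step_ok; case: ifPn => [rD ->|_].
    by rewrite (soon_rem _ _ rD).
  case: ifP => [_ ->|_ [x xD ->]]; rewrite soon_cons //.
  by rewrite leq_add2l (soon_rem _ _ xD) leq_addl.
(* In the right case LFD evicts a page due within [t]. It was the furthest, so all pages that stay
   are due too, and by [ltD] the competitor cannot hold more. *)
have geC : (index r I < t) +
    (if r \in C then soon t I (rem r C) else soon t I C) <= soon t I C' \/
    r \notin C /\ k + (index r I < t) <= (soon t I C').+1.
  rewrite /C'; case: ifPn => [rC|rC].
    by left; rewrite (soon_rem _ _ rC).
  case: ifPn => [_|]; first by left.
  rewrite -leqNgt => kC.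
  have [|] := LFD pre r I C uC _ rC; first lia.
  set x := ev _ _ _ => xC far; rewrite soon_cons (soon_rem t I xC).
  case: (ltnP (index x I) t) => xt; last by left.
  right; split => //; case: far => [|[_ far]].
    by rewrite -index_mem -leqNgt; lia.
  have -> : soon t I (rem x C) = size (rem x C).
    apply/eqP; rewrite -all_count; apply/allP => y /mem_rem /far; lia.
  by rewrite size_rem //; lia.
have ltD : soon t I D' <= (index r I < t) + k.-1.
  have rD' : r \in D' by have [] := step_ok_inv k0 stD uD sD.
  rewrite (soon_rem _ _ rD') leq_add2l (leq_trans (soon_le_size _ _ _)) //.
  by rewrite size_rem //; lia.
move: leD geC; rewrite /m'.
case rC: (r \in C); case rD: (r \in D) => /=;
  rewrite ?(soonS_in _ _ rC uC) ?(soonS_in _ _ rD uD)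
    ?(soonS_notin _ _ (negbT rC)) ?(soonS_notin _ _ (negbT rD));
  move=> leD [geC|[//_ geC]]; lia.
Qed.

End Offline.

(** * Averages over random orders *)

Section RandomOrder.
Variables (R : realFieldType) (U : eqType).
Implicit Types (s t : seq U) (x : U).
Local Open Scope ring_scope.

Definition avg (T : Type) (s : seq T) (f : T -> R) : R :=
  (size s)%:R^-1 * \sum_(x <- s) f x.

Definition insert x i t := take i t ++ x :: drop i t.

Lemma rem_insert x i t : x \notin t -> rem x (insert x i t) = t.
Proof.
move=> xt; have xti : x \notin take i t by apply: contra xt; apply: mem_take.
rewrite /insert remE index_cat (negbTE xti) /= eqxx addn0 take_size_cat //.
by rewrite -cat_rcons drop_size_cat ?size_rcons // cat_take_drop.
Qed.

Lemma index_insert x i t :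
  x \notin t -> (i <= size t)%N -> index x (insert x i t) = i.
Proof.
move=> xt it; have xti : x \notin take i t by apply: contra xt; apply: mem_take.
by rewrite /insert index_cat (negbTE xti) /= eqxx addn0 size_takel.
Qed.

Lemma notin_permutations_rem x s t :
  uniq s -> t \in permutations (rem x s) -> x \notin t.
Proof.
by rewrite mem_permutations => us /perm_mem ->; rewrite mem_rem_uniqF.
Qed.

Lemma size_permutations_rem x s t :
  x \in s -> t \in permutations (rem x s) -> size t = (size s).-1.
Proof. by rewrite mem_permutations => xs /perm_size ->; rewrite size_rem. Qed.

(** A uniform order of [s] thus amounts to a uniform order of the other pages and an independent
    uniform position for [x]. *)
Lemma perm_permutations_insert x s : x \in s -> uniq s ->
  perm_eq (permutations s)
    [seq insert x i t | t <- permutations (rem x s), i <- iota 0 (size s)].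
Proof.
move=> xs us; apply: uniq_perm; first exact: permutations_uniq.
  apply: allpairs_uniq; rewrite ?permutations_uniq ?iota_uniq //.
  move=> [t i] [t' i'] /allpairsP[[u j] /= [ut ji [-> ->]]].
  move=> /allpairsP[[u' j'] /= [ut' ji' [-> ->]]] eqtt'.
  have xu := notin_permutations_rem us ut.
  have xu' := notin_permutations_rem us ut'.
  have su := size_permutations_rem xs ut.
  have su' := size_permutations_rem xs ut'.
  move: ji ji'; rewrite !mem_iota /= !add0n => js js'.
  congr pair; first by rewrite -(rem_insert j xu) eqtt' rem_insert.
  by rewrite -(@index_insert x j u) ?eqtt' ?index_insert //; lia.
move=> t; rewrite mem_permutations; apply/idP/allpairsP.
  move=> ts; have xt : x \in t by rewrite (perm_mem ts).
  exists (rem x t, index x t); split => /=.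
  - rewrite mem_permutations -(perm_cons x).
    by rewrite -(permPr (perm_to_rem xs)) -(permPl (perm_to_rem xt)).
  - by rewrite mem_iota add0n -(perm_size ts) index_mem.
  - rewrite /insert remE take_size_cat ?size_takel ?index_size //.
    rewrite drop_size_cat ?size_takel ?index_size //.
    rewrite -{1}(cat_take_drop (index x t) t) (drop_nth x) ?index_mem //.
    by rewrite nth_index.
move=> [[u i] /= [+ _ ->]]; rewrite mem_permutations => us'.
rewrite (permPr (perm_to_rem xs)) /insert.
by rewrite perm_catC cat_cons perm_cons perm_catC cat_take_drop.
Qed.

Lemma eq_in_avg (T : eqType) (s : seq T) (f g : T -> R) :
  {in s, f =1 g} -> avg s f = avg s g.
Proof. by move=> fg; rewrite /avg; congr (_ * _); apply: eq_big_seq. Qed.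

Lemma ler_avg (T : eqType) (s : seq T) (f g : T -> R) :
  {in s, forall y, f y <= g y} -> avg s f <= avg s g.
Proof.
move=> fg; rewrite /avg ler_wpM2l ?invr_ge0 //.
by rewrite big_seq [leRHS]big_seq; apply: ler_sum => y /fg.
Qed.

Lemma avgD T (s : seq T) (f g : T -> R) :
  avg s (fun y => f y + g y) = avg s f + avg s g.
Proof. by rewrite /avg big_split mulrDr. Qed.

Lemma avg_const T (s : seq T) c : (0 < size s)%N -> avg s (fun=> c) = c.
Proof.
move=> s0; rewrite /avg big_const_seq count_predT iter_addr_0.
by rewrite -[c *+ _]mulr_natl mulrA mulVf ?mul1r // pnatr_eq0; lia.
Qed.

Lemma size_permutations_gt0 s : (0 < size (permutations s))%N.
Proof.
have : s \in permutations s by rewrite mem_permutations.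
by case: permutations.
Qed.

Lemma avg_permutations_insert x s f : x \in s -> uniq s ->
  avg (permutations s) f =
  avg (permutations (rem x s))
    (fun t => avg (iota 0 (size s)) (fun i => f (insert x i t))).
Proof.
move=> xs us; have sg0 : (0 < size s)%N by case: (s) xs.
rewrite /avg (perm_big _ (perm_permutations_insert xs us)) big_allpairs_dep.
rewrite !size_permutations ?rem_uniq // size_rem // size_iota -mulr_sumr mulrA.
by rewrite -{1}(prednK sg0) factS (prednK sg0) natrM invfM [_^-1 * _]mulrC.
Qed.

(** Keeps the order of the old pages uniform when the requested page leaves them. *)
Lemma avg_permutations_rem x s f : uniq s ->
  avg (permutations s) (fun t => f (rem x t)) = avg (permutations (rem x s)) f.
Proof.
move=> us; case: (boolP (x \in s)) => [xs|xs]; last first.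
  rewrite (rem_id xs); apply: eq_in_avg => t; rewrite mem_permutations => ts.
  by rewrite rem_id ?(perm_mem ts).
rewrite (avg_permutations_insert _ xs us); apply: eq_in_avg => t.
move=> /(notin_permutations_rem us) xt.
rewrite -[RHS](avg_const (s := iota 0 (size s))).
  by apply: eq_in_avg => i _; rewrite rem_insert.
by rewrite size_iota; case: (s) xs.
Qed.

(** The position of [x] is uniform, and [x] is lost only from one of the first [d] positions. *)
Lemma avg_permutations_notin_drop x s d : x \in s -> uniq s ->
  avg (permutations s) (fun t => (x \notin drop d t)%:R)
    <= d%:R / (size s)%:R.
Proof.
move=> xs us; rewrite (avg_permutations_insert _ xs us).
rewrite -[leRHS](avg_const (s := permutations (rem x s))) //;
  last exact: size_permutations_gt0.
apply: ler_avg => t ts; have xt := notin_permutations_rem us ts.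
rewrite /avg size_iota mulrC ler_wpM2r ?invr_ge0 //.
have le_i i : i \in iota 0 (size s) ->
    ((x \notin drop d (insert x i t)) <= (i < d))%N.
  rewrite mem_iota add0n => /andP[_ ilt]; case: (ltnP i d) => [_|di].
    exact: leq_b1.
  have it : (i <= size t)%N by rewrite (size_permutations_rem xs ts); lia.
  have xin : x \in insert x i t by rewrite mem_cat mem_head orbT.
  have := xin; rewrite -{1}(cat_take_drop d (insert x i t)) mem_cat in_take //.
  by rewrite index_insert // ltnNge di /= => ->.
rewrite -natr_sum ler_nat.
apply: (@leq_trans (count (ltn^~ d) (iota 0 (size s)))).
  rewrite -sum1_count [leqRHS]big_mkcond big_seq [leqRHS]big_seq.
  by apply: leq_sum => i /le_i; rewrite /ltn /=; case: (i < d)%N.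
rewrite -size_filter -[leqRHS](size_iota 0); apply: uniq_leq_size.
  by rewrite filter_uniq ?iota_uniq.
by move=> i; rewrite mem_filter !mem_iota /= add0n => /andP[].
Qed.

End RandomOrder.

(** * Pages kept by the offline algorithm *)

Section GroundTruth.
Variables (U : eqType) (k : nat).
Implicit Types (D I S T : seq U) (r x : U) (ds : seq (seq U)).

(* [D] is the current cache, [ds] the caches after each request of [I]: [x] is
   held now and until its next request. *)
Definition kept I ds D x :=
  (x \in D) && all (fun D' => x \in D') (take (index x I) ds).

(** Only the requested page can enter the cache, so the fate of any other page was settled at its
    last request: a wrong 0-prediction stays broken until the page returns. *)
Lemma kept_cons r I D D' ds x :
  {subset D' <= r :: D} -> x != r ->
  kept (r :: I) (D' :: ds) D x = kept I ds D' x.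
Proof.
move=> sub xr; rewrite /kept /= eq_sym (negbTE xr) /=.
case xD': (x \in D'); last by rewrite /= andbF.
by have := sub _ xD'; rewrite inE (negbTE xr) /= => ->.
Qed.

Lemma kept_head r I D D' ds : kept (r :: I) (D' :: ds) D r = (r \in D).
Proof. by rewrite /kept /= eqxx take0 andbT. Qed.

Definition broken I ds D := count (predC (kept I ds D)).

(* [S] will be the marked and old pages: a request to an orphan is a miss for the
   algorithm but not for the offline one. *)
Definition orphans I ds D (S : seq U) :=
  count (fun x => kept I ds D x && (x \notin S)) D.

Lemma broken_rem r I D D' ds S :
  {subset D' <= r :: D} -> uniq S ->
  broken I ds D' (rem r S) <= broken (r :: I) (D' :: ds) D S.
Proof.
move=> sub uS.
apply: (leq_trans _ (leq_count_subseq _ (rem_subseq r S))).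
rewrite /broken (@eq_in_count _ _ (predC (kept (r :: I) (D' :: ds) D))) // => x.
by rewrite mem_rem_uniq // inE => /andP[/= xr _]; rewrite (kept_cons _ _ sub).
Qed.

(** The kept pages of [S] lie in [D] and differ from [r], so there are at most [k - 1]. The strict
    bound is what covers one more hole. *)
Lemma size_le_broken I ds D r S :
  uniq D -> size D <= k -> r \in D -> uniq S -> r \notin S ->
  size S < k + broken I ds D S.
Proof.
move=> uD sD rD uS rS.
have : count (kept I ds D) S <= size (rem r D).
  rewrite -size_filter; apply: uniq_leq_size; first by rewrite filter_uniq.
  move=> x; rewrite mem_filter mem_rem_uniq // => /andP[/andP[xD _] xS].
  by rewrite inE xD andbT /=; apply: contra rS => /eqP <-.
rewrite size_rem // -(count_predC (kept I ds D) S) -/(broken _ _ _ _).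
by case: (D) rD sD => //= *; lia.
Qed.

Lemma orphans_cat I ds D S T :
  uniq D -> orphans I ds D S <= orphans I ds D (S ++ T) + size T.
Proof.
move=> uD; apply: (@leq_trans (orphans I ds D (S ++ T) + count [in T] D)).
  rewrite /orphans -count_predUI -[leqLHS]addn0 leq_add //.
  apply: sub_count => x /= /andP[-> xS]; rewrite mem_cat negb_or xS /=.
  by case: (x \in T).
rewrite leq_add2l -size_filter; apply: uniq_leq_size; first exact: filter_uniq.
by move=> x; rewrite mem_filter => /andP[].
Qed.

(** An offline hit outside [S] uses up an orphan; a new one arises only when a kept page is
    predicted 1, which is a wrong 1-prediction. *)
Lemma orphans_step r (b : bool) I D D' ds S S0 :
  uniq D -> uniq D' -> r \in D' -> {subset D' <= r :: D} ->
  r \notin S0 -> (forall x, x != r -> (x \in S0) = (x \in S)) ->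
  orphans I ds D' (if b then S0 else r :: S0) + ((r \in D) && (r \notin S)) <=
  orphans (r :: I) (D' :: ds) D S + (b && kept I ds D' r).
Proof.
move=> uD uD' rD' sub rS0 eqS; rewrite /orphans.
set P' := (fun x => kept I ds D' x && _).
set P := (fun x => kept (r :: I) _ D x && _).
have le_rem : count P' (rem r D') <= count P (rem r D).
  rewrite -!size_filter; apply: uniq_leq_size.
    by rewrite filter_uniq ?rem_uniq.
  move=> x; rewrite !mem_filter !mem_rem_uniq // !inE => /and3P[P'x xr xD'].
  have := sub _ xD'; rewrite inE (negbTE xr) /= => ->.
  rewrite /P (kept_cons _ _ sub) // -eqS //= andbT.
  move: P'x; rewrite /P'; case: (b) => //.
  by rewrite inE negb_or => /and3P[-> _ ->].
rewrite (permP (perm_to_rem rD')) /=.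
have -> : P' r = b && kept I ds D' r.
  by rewrite /P'; case: (b); rewrite ?rS0 ?andbT // mem_head andbF.
case rD: (r \in D) => /=; last by rewrite -(rem_id (negbT rD)); lia.
have Pr : P r = (r \notin S) by rewrite /P kept_head rD.
by rewrite [in leqRHS](permP (perm_to_rem rD)) /= Pr; lia.
Qed.

End GroundTruth.

(** * The algorithm *)

Section MarkAndPredict.
Variables (U : eqType) (k : nat).
Hypothesis k_gt0 : 0 < k.
Implicit Types (C M L V X : seq U) (r x : U) (b : bool).

(* [old] is in random order, and its first [holes] elements are the dropped pages;
   [holes] may exceed the length of [old].  Drawing the order once per phase makes
   the rest of the phase deterministic, [holes] included. *)
Record vstate := VState { marked : seq U; old : seq U; holes : nat }.
Implicit Types (v : vstate).

Definition vcache v := marked v ++ drop (holes v) (old v).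

Definition vinv v := [/\ uniq (marked v ++ old v), size (marked v) <= k,
  size (old v) <= k & size (marked v) + size (old v) <= k + holes v].

Definition restarts v r := (r \notin marked v) && (k <= size (marked v)).

(** A hole is added exactly when the other pages leave no room for [r], whatever [b] is. If [r] was
    itself dropped, [holes] stays and the next old page, if any, slides into the dropped prefix. *)
Definition advance v r b :=
  let M := rem r (marked v) in
  let L := rem r (old v) in
  VState (if b then M else r :: M) L
    (holes v + (k + holes v <= size M + size L)).

Lemma vinv_restart v L :
  vinv v -> L \in permutations (marked v) -> vinv (VState [::] L 0).
Proof.
rewrite mem_permutations => -[uML sM _ _] LM.
have uL : uniq L.
  by rewrite (perm_uniq LM); move: uML; rewrite cat_uniq => /andP[].
by have sL := perm_size LM; split => //=; lia.
Qed.

Lemma restart_not_restarts L r : ~~ restarts (VState [::] L 0) r.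
Proof. by rewrite /restarts /= leqNgt k_gt0. Qed.

(** With [k] marked pages the invariant forces [holes] to cover all old pages, so a restart leaves
    the virtual cache unchanged. *)
Lemma vcache_restart v r :
  vinv v -> restarts v r -> vcache v = marked v.
Proof.
move=> [_ _ _ hole] /andP[_ kM]; rewrite /vcache drop_oversize ?cats0 //; lia.
Qed.

Lemma size_rems r v : vinv v ->
  size (rem r (marked v)) + size (rem r (old v)) =
  size (marked v) + size (old v) - (r \in marked v ++ old v).
Proof.
move=> [uML _ _ _]; move: uML; rewrite cat_uniq mem_cat => /and3P[_ disj _].
case rM: (r \in marked v).
  have rL : r \notin old v by apply: contra disj => rL; apply/hasP; exists r.
  by rewrite (rem_id rL) size_rem //; case: (marked v) rM => //=; lia.
rewrite [rem r (marked v)]rem_id ?rM //=; case rL: (r \in old v).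
  by rewrite size_rem //; case: (old v) rL => //=; lia.
by rewrite rem_id ?rL ?subn0.
Qed.

Lemma uniq_rems v r : vinv v ->
  [/\ r \notin rem r (marked v) ++ rem r (old v),
    uniq (rem r (marked v) ++ rem r (old v)) &
    forall x, x != r ->
      (x \in rem r (marked v) ++ rem r (old v)) = (x \in marked v ++ old v)].
Proof.
move=> [uML _ _ _]; have := uML; rewrite cat_uniq => /and3P[uM _ uL].
rewrite !rem_filter // -filter_cat mem_filter /= eqxx filter_uniq //.
by split => // x xr; rewrite mem_filter /= xr.
Qed.

Lemma size_marked_rem v r :
  vinv v -> ~~ restarts v r -> size (rem r (marked v)) < k.
Proof.
move=> [_ sM _ _]; rewrite /restarts negb_and negbK -ltnNge.
case rM: (r \in marked v) => /=; last by rewrite rem_id ?rM.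
by rewrite size_rem //; lia.
Qed.

Lemma vinv_advance v r b : vinv v -> ~~ restarts v r -> vinv (advance v r b).
Proof.
move=> vv nr; have [rML uML _] := uniq_rems r vv.
have sM := size_marked_rem vv nr; have sML := size_rems r vv.
case: vv => _ _ sL hole; have sL' := size_subseq (rem_subseq r (old v)).
split.
- by rewrite /advance /=; case: (b) => //=; rewrite rML.
- by rewrite /advance /=; case: (b) => //=; lia.
- by rewrite /=; lia.
- by rewrite /advance /=; case: (b) => /=; lia.
Qed.

Lemma drop_rem_subset r d L : {subset drop d (rem r L) <= drop d L}.
Proof.
elim: L d => [|y L IH] [|d] x //; first by rewrite !drop0; apply: mem_rem.
rewrite /=; case: eqP => _ //=; last exact: IH.
by rewrite -add1n -drop_drop => /mem_drop.
Qed.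

(** [X] is what survives besides [r]; [size X < k] is the room in which the real cache can load
    [r]. *)
Lemma vcache_advance v r b : vinv v -> ~~ restarts v r ->
  exists X, [/\ size X < k, {subset X <= vcache v} &
    {subset vcache (advance v r b) <= r :: X}].
Proof.
move=> vv nr; have sM := size_marked_rem vv nr.
exists (rem r (marked v) ++
  drop (holes (advance v r b)) (rem r (old v))); split.
- have sML := size_rems r vv; case: vv => _ _ _ hole.
  by rewrite size_cat size_drop /=; lia.
- move=> x; rewrite !mem_cat => /orP[/mem_rem -> //|].
  rewrite /= addnC -drop_drop => /mem_drop /drop_rem_subset ->.
  exact: orbT.
- move=> x; rewrite /vcache /=; case: (b); rewrite ?inE // => ->.
  exact: orbT.
Qed.

(** * Lazy eviction in the real cache *)

(** If all of [C] lies in [V], the default [head r C] still names a cached page, so that [load] is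
    legal in every state, reachable or not. *)
Definition evictee C (V : seq U) r :=
  nth (head r C) C (find (fun x => x \notin V) C).

Definition load r V C :=
  if r \in C then C else if size C < k then r :: C
  else r :: rem (evictee C V r) C.

Lemma load_ok r V C : step_ok k r C (load r V C).
Proof.
rewrite /step_ok /load; case rC: (r \in C) => //.
case: (ltnP (size C) k) => // kC.
exists (evictee C V r) => //; rewrite /evictee.
case: (ltnP (find (fun x => x \notin V) C) (size C)) => [lt|ge].
  exact: mem_nth.
by rewrite nth_default //; case: (C) kC => [|y s]; rewrite ?mem_head //=; lia.
Qed.

Lemma load_uniq r V C : uniq C -> uniq (load r V C).
Proof.
rewrite /load => uC; case: ifPn => // rC; case: ifP => _ /=.
  by rewrite rC.
by rewrite rem_uniq // andbT; apply: contra rC; apply: mem_rem.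
Qed.

(** A full [C] has a page outside [V]: otherwise the more than [k] distinct pages of [r :: C] would
    fit in [r :: X]. *)
Lemma load_subset r V C X : uniq C -> size X < k -> {subset X <= C} ->
  {subset V <= r :: X} -> {subset V <= load r V C}.
Proof.
move=> uC sX XC VX x xV; rewrite /load.
have := VX _ xV; rewrite inE; case: eqP => [-> _|/eqP xr /= xX].
  by case: ifP => // _; case: ifP => _; apply: mem_head.
have xC := XC _ xX; case: ifPn => // rC; case: (ltnP (size C) k) => kC.
  by rewrite inE xC orbT.
rewrite inE rem_mem ?orbT //; apply: contraL xV => /eqP ->.
suff hasV : has (fun y => y \notin V) C.
  by have := nth_find (head r C) hasV.
apply/negPn/negP => /hasPn CV.
suff : size (r :: C) <= size (r :: X) by rewrite /=; lia.
apply: uniq_leq_size; first by rewrite /= rC.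
move=> y; rewrite inE => /orP[/eqP ->|/CV]; first exact: mem_head.
by rewrite negbK; apply: VX.
Qed.

(** * The randomized algorithm and its virtual cost *)

Variable R : realType.
Local Open Scope ring_scope.

Definition vstep v r b : seq (R * vstate) :=
  let Ls := permutations (marked v) in
  if restarts v r then
    [seq ((size Ls)%:R^-1, advance (VState [::] L 0) r b) | L <- Ls]
  else [:: (1, advance v r b)].

Fixpoint vcost v (rs : seq (U * bool)) : R :=
  match rs with
  | [::] => 0
  | (r, b) :: rs' =>
      (r \notin vcache v)%:R + \sum_(q <- vstep v r b) q.1 * vcost q.2 rs'
  end.

(** The virtual cache is no legal cache, since it gives up pages predicted 1 at once; the real one
    contains it and evicts only on faults. *)
Definition mark_and_predict : ralg U R :=
  RAlg ([::], VState [::] [::] 0) fst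
    (fun s r b =>
      [seq (q.1, (load r (vcache q.2) s.1, q.2)) | q <- vstep s.2 r b]).

Lemma In_map (A B : Type) (f : A -> B) y s :
  List.In y (map f s) -> exists2 x, List.In x s & y = f x.
Proof.
elim: s => //= x s IH [<-|/IH [z zs ->]]; first by exists x; [left|].
by exists z; [right|].
Qed.

Lemma mark_and_predict_ok : ralg_ok k mark_and_predict.
Proof.
split=> // -[C v] r b; split=> [|q].
  rewrite /= big_map /= /vstep; case: ifP => _; last by rewrite big_seq1.
  rewrite big_map /= big_const_seq count_predT iter_addr_0.
  rewrite -[_^-1 *+ _]mulr_natr mulVf //.
  by rewrite pnatr_eq0 -lt0n size_permutations_gt0.
move=> inq; have [[w v'] /= vw ->] := In_map inq.
split; last exact: load_ok.
move: vw; rewrite /vstep; case: ifP => _ => [vw|[[<- _]|[]]] //.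
by have [L _ [-> _]] := In_map vw; rewrite invr_ge0.
Qed.

Lemma vcost_restart v r b rs : restarts v r ->
  vcost v ((r, b) :: rs) = (r \notin vcache v)%:R +
    avg (permutations (marked v))
      (fun L => vcost (advance (VState [::] L 0) r b) rs).
Proof.
by move=> rv; rewrite /= /vstep rv big_map /= /avg mulr_sumr.
Qed.

Lemma vcost_advance v r b rs : ~~ restarts v r ->
  vcost v ((r, b) :: rs) = (r \notin vcache v)%:R + vcost (advance v r b) rs.
Proof. by move=> rv; rewrite /= /vstep (negbTE rv) big_seq1 mul1r. Qed.

Lemma ecost_le_vcost C v rs : uniq C -> vinv v -> {subset vcache v <= C} ->
  ecost_from (A := mark_and_predict) (C, v) rs <= vcost v rs.
Proof.
elim: rs C v => [|[r b] rs IH] C v uC vv vC //.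
have le_miss : (r \notin C)%:R <= (r \notin vcache v)%:R :> R.
  rewrite ler_nat; case: (boolP (r \in vcache v)) => [/vC ->|_] //.
  exact: leq_b1.
have adv u : vinv u -> ~~ restarts u r -> {subset vcache u <= C} ->
    ecost_from (A := mark_and_predict)
      (load r (vcache (advance u r b)) C, advance u r b) rs
    <= vcost (advance u r b) rs.
  move=> uu nr uC'; have [X [sX XC sub]] := vcache_advance b uu nr.
  apply: IH; [exact: load_uniq|exact: vinv_advance|].
  by apply: (load_subset uC sX) sub => x /XC /uC'.
rewrite /= big_map /=; apply: lerD => //.
rewrite /vstep; case: ifPn => [rv|nr]; last first.
  by rewrite !big_seq1 !mul1r; apply: adv.
rewrite !big_map /= big_seq [leRHS]big_seq; apply: ler_sum => L LM.
rewrite ler_wpM2l ?invr_ge0 //; apply: adv.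
- exact: vinv_restart LM.
- exact: restart_not_restarts.
- move=> x; rewrite /vcache /= drop0 => xL; apply: vC.
  rewrite (vcache_restart vv rv); move: LM.
  by rewrite mem_permutations => /perm_mem <-.
Qed.

(** * Harmonic numbers and the potential argument *)

Lemma harmonicS n : harmonic R n.+1 = harmonic R n + n.+1%:R^-1.
Proof. by rewrite /harmonic big_nat_recr. Qed.

Lemma harmonic_le m n : (m <= n)%N -> harmonic R m <= harmonic R n.
Proof.
move=> /subnK <-; elim: (n - m)%N => // d IH.
by rewrite addSn harmonicS ler_wpDr ?invr_ge0.
Qed.

Lemma harmonic_ge0 n : 0 <= harmonic R n.
Proof. by apply: sumr_ge0 => i _; rewrite invr_ge0. Qed.

Lemma harmonic_ge1 n : (0 < n)%N -> 1 <= harmonic R n.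
Proof.
by move=> /harmonic_le; apply: le_trans; rewrite /harmonic big_nat1 invr1.
Qed.

(** A marked page is a hit; an old one is missed with probability at most [d / size T], paid by the
    drop of the harmonic term; any other page is an offline miss or an orphan. *)
Lemma avg_miss_le r M T d B (D : seq U) : vinv (VState M T d) -> (d <= B)%N ->
  avg (permutations T) (fun L => (r \notin vcache (VState M L d))%:R) <=
  (r \notin D)%:R + ((r \in D) && (r \notin M ++ T))%:R
    + B%:R * harmonic R (size T) - B%:R * harmonic R (size (rem r T)).
Proof.
move=> [/= uMT _ _ _] dB; move: uMT; rewrite cat_uniq => /and3P[_ disj uT].
have rhs_ge0 : 0 <= (r \notin D)%:R + ((r \in D) && (r \notin M ++ T))%:R :> R.
  by rewrite -natrD.
have le_T :
    0 <= B%:R * harmonic R (size T) - B%:R * harmonic R (size (rem r T)).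
  rewrite -mulrBr mulr_ge0 // subr_ge0; apply: harmonic_le.
  exact: size_subseq (rem_subseq r T).
case: (boolP (r \in M)) => [rM|rM].
  rewrite (@eq_in_avg _ _ _ _ (fun=> 0)) => [|L _]; last first.
    by rewrite /vcache mem_cat rM.
  by rewrite avg_const ?size_permutations_gt0 // -addrA addr_ge0 // addrAC; lra.
case: (boolP (r \in T)) => [rT|rT].
  have T0 : (0 < size T)%N by case: (T) rT.
  have -> : harmonic R (size T) = harmonic R (size (rem r T)) + (size T)%:R^-1.
    by rewrite -[in LHS](prednK T0) harmonicS prednK // size_rem.
  have le_dB : d%:R / (size T)%:R <= B%:R / (size T)%:R :> R.
    by rewrite ler_wpM2r ?invr_ge0 // ler_nat.
  have le_d : avg (permutations T) (fun L =>
      (r \notin vcache (VState M L d))%:R) <= d%:R / (size T)%:R :> R.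
    rewrite (le_trans _ (avg_permutations_notin_drop R d rT uT)) //.
    by apply: ler_avg => L _; rewrite /vcache /= mem_cat (negbTE rM).
  by rewrite mulrDr; move: le_d le_dB rhs_ge0; lra.
rewrite mem_cat negb_or rM rT /= andbT rem_id // addrK.
rewrite -natrD; have -> : ((r \notin D) + (r \in D))%N = 1%N by case: (r \in D).
rewrite -[leRHS](@avg_const _ _ (permutations T)) ?size_permutations_gt0 //.
by apply: ler_avg => L _; rewrite ler_nat leq_b1.
Qed.

Lemma pred_err_cons h b p c ps :
  pred_err h (b :: p) (c :: ps) = ((b == h) && (c == ~~ h) + pred_err h p ps)%N.
Proof. by []. Qed.

(* [Bc] and [B] bound the wrong 0-predictions made in the current phase and in
   the last two phases.  A future wrong 0-prediction adds one to both, which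
   costs at most [2 H_k]; a request to an old page is missed with probability
   at most [B / size T], the amount by which [B * H_(size T)] then drops. *)
Lemma avg_vcost_le (I D : seq U) p ds M T d Bc B :
  size p = size I -> traj_ok k D I ds -> uniq D -> (size D <= k)%N ->
  vinv (VState M T d) ->
  (broken I ds D M <= Bc)%N -> (broken I ds D (M ++ T) <= B)%N -> (d <= B)%N ->
  avg (permutations T) (fun L => vcost (VState M L d) (zip I p)) <=
    (traj_cost D I ds)%:R
    + 2 * harmonic R k * (pred_err false p (pstar_aux I ds))%:R
    + (pred_err true p (pstar_aux I ds))%:R
    + harmonic R k * Bc%:R + B%:R * harmonic R (size T)
    + (orphans I ds D (M ++ T))%:R.
Proof.
have H0 := harmonic_ge0.
elim: I p D ds M T d Bc B => [|r I IH] [|b p] //= D [|D' ds] // M T d Bc B.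
  move=> _ _ _ _ _ _ _ _.
  rewrite avg_const ?size_permutations_gt0 // !addr_ge0 ?mulr_ge0 //.
move=> [sp] [stD trD] uD sD.
have [uD' sD' rD' subD] := step_ok_inv k_gt0 stD uD sD.
(* Serves a request within a phase, and also the first request after a restart. *)
have step M1 T1 d1 Bc1 B1 : vinv (VState M1 T1 d1) ->
    ~~ restarts (VState M1 T1 d1) r ->
    (broken (r :: I) (D' :: ds) D M1 <= Bc1)%N ->
    (broken (r :: I) (D' :: ds) D (M1 ++ T1) <= B1)%N -> (d1 <= B1)%N ->
    avg (permutations T1)
      (fun L => vcost (VState M1 L d1) ((r, b) :: zip I p)) <=
    ((r \notin D) + traj_cost D' I ds)%:R
    + 2 * harmonic R k *
        (pred_err false (b :: p) (~~ kept I ds D' r :: pstar_aux I ds))%:R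
    + (pred_err true (b :: p) (~~ kept I ds D' r :: pstar_aux I ds))%:R
    + harmonic R k * Bc1%:R + B1%:R * harmonic R (size T1)
    + (orphans (r :: I) (D' :: ds) D (M1 ++ T1))%:R.
  move=> vv nr leBc leB dB.
  have vv' := vinv_advance b vv nr.
  have [rMT uMT eqMT] := uniq_rems r vv.
  have [/= uMT1 _ sT1 _] := vv.
  have [uM1 uT1] : uniq M1 /\ uniq T1.
    by move: uMT1; rewrite cat_uniq => /and3P[].
  set err0 := (~~ b && ~~ kept I ds D' r : nat).
  set v' := advance (VState M1 T1 d1) r b.
  have brM : (broken I ds D' (rem r M1) <= broken (r :: I) (D' :: ds) D M1)%N.
    exact: broken_rem.
  have brMT : (broken I ds D' (rem r M1 ++ rem r T1)
               <= broken (r :: I) (D' :: ds) D (M1 ++ T1))%N.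
    have := broken_rem I ds subD uMT1; rewrite !rem_filter //.
    by rewrite filter_cat.
  have leBc' : (broken I ds D' (marked v') <= Bc1 + err0)%N.
    rewrite /v' /err0 /=; case: (b) => /=;
      rewrite /broken /= -!/(broken _ _ _ _); lia.
  have leB' : (broken I ds D' (marked v' ++ old v') <= B1 + err0)%N.
    rewrite /v' /err0 /=; case: (b) => /=;
      rewrite /broken /= -!/(broken _ _ _ _); lia.
  have dB' : (holes v' <= B1 + err0)%N.
    have := size_le_broken I ds uD' sD' rD' uMT rMT.
    rewrite /v' /= size_cat; lia.
  have leN := orphans_step b I ds uD uD' rD' subD rMT eqMT.
  have := IH p D' ds (marked v') (old v') (holes v') _ _
    sp trD uD' sD' vv' leBc' leB' dB'.
  have := @avg_miss_le r M1 T1 d1 B1 D vv dB.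
  rewrite (@eq_in_avg _ _ _ (fun L => vcost (VState M1 L d1) ((r, b) :: zip I p))
    (fun L => (r \notin vcache (VState M1 L d1))%:R +
      vcost (VState (marked v') (rem r L) (holes v')) (zip I p))); last first.
    move=> L; rewrite mem_permutations => LT; rewrite vcost_advance //.
    congr (_ + vcost (VState _ _ _) _).
    (* The new [holes] depends on the old pages only through their number, so it is the same for
       every order [L]. *)
    rewrite /v' /= -!(count_predT (rem r _)) !count_rem !count_predT.
    by rewrite (perm_mem LT) (perm_size LT).
  rewrite avgD (avg_permutations_rem r
    (fun L => vcost (VState (marked v') L (holes v')) (zip I p))) //.
  rewrite !pred_err_cons /= !natrD.
  move: leN; rewrite /= -(ler_nat R) !natrD.
  (* Bounds by [2 * harmonic R k] the cost of raising both [Bc1] and [B1] by [err0]. *)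
  have := harmonic_le (leq_trans (size_subseq (rem_subseq r T1)) sT1).
  by rewrite /err0; case: (b); case: (kept I ds D' r) => /=; lra.
move=> vv leBc leB dB.
case: (boolP (restarts (VState M T d) r)) => [rv|nr]; last exact: step.
have [/= _ sM sT hole] := vv; have /andP[/= rM kM] := rv.
have vM : vinv (VState [::] M 0).
  by apply: (vinv_restart vv); rewrite mem_permutations.
(* The marked pages become the old ones, so [Bc] takes the place of [B]; as [size M = k], the term
   [harmonic R k * Bc] pays for it. *)
have := step [::] M 0%N 0%N Bc vM (restart_not_restarts _ _)
  (leq0n _) leBc (leq0n _).
have vcost_eq L : vcost (VState M L d) ((r, b) :: zip I p) <=
    avg (permutations M)
      (fun L' => vcost (VState [::] L' 0) ((r, b) :: zip I p)).
  rewrite (vcost_restart (v := VState M L d) b _ rv).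
  rewrite (@eq_in_avg _ _ (permutations M)
    (fun L' => vcost (VState [::] L' 0) ((r, b) :: zip I p)) (fun L' =>
      1 + vcost (advance (VState [::] L' 0) r b) (zip I p))) => [|L' LM].
    by rewrite avgD avg_const ?size_permutations_gt0 // lerD2r lern1 leq_b1.
  rewrite vcost_advance ?restart_not_restarts // /vcache /= drop0.
  by move: LM; rewrite mem_permutations => /perm_mem ->; rewrite rM.
have := ler_avg (fun L _ => vcost_eq L) (s := permutations T).
rewrite avg_const ?size_permutations_gt0 //= => le1 le2.
have : (orphans (r :: I) (D' :: ds) D M)%:R <=
    (orphans (r :: I) (D' :: ds) D (M ++ T))%:R + (size T)%:R :> R.
  by rewrite -natrD ler_nat orphans_cat.
(* The leftover potential of the ended phase pays for the orphans created by forgetting [T]: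
   [size T <= d <= B]. *)
have : (size T)%:R <= B%:R * harmonic R (size T).
  case: (posnP (size T)) => [-> |T0]; first by rewrite mulr_ge0.
  apply: (@le_trans _ _ (B%:R * 1)); first by rewrite mulr1 ler_nat; lia.
  by rewrite ler_wpM2l // harmonic_ge1.
move: le1 le2; have -> : size M = k by lia.
lra.
Qed.

End MarkAndPredict.

Theorem theorem2 (R : realType) (U : eqType) (k : nat)
    (ev : seq U -> nat -> seq U -> U) :
  (1 <= k)%N -> is_LFD k ev ->
  exists A : ralg U R, ralg_ok k A /\
    exists b : R, forall (I : seq U) (p : seq bool),
      size p = size I ->
      forall cs : seq (seq U), offline_ok k I cs ->
        (ecost A I p <=
           (offline_cost I cs)%:R
           + 2 * harmonic R k * (pred_err false p (pstar k ev I))%:R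
           + (pred_err true p (pstar k ev I))%:R + b)%R.
Proof.
move=> k0 LFD; exists (mark_and_predict U k R).
split; first exact: mark_and_predict_ok.
(* All caches start empty, so every potential term vanishes initially. *)
exists 0%R => I p sp cs cs_ok; rewrite addr0.
have v0 : vinv k (VState ([::] : seq U) [::] 0) by [].
have le_v : (ecost (mark_and_predict U k R) I p
    <= vcost k R (VState [::] [::] 0) (zip I p))%R.
  by apply: (@ecost_le_vcost U k k0 R [::]).
apply: (le_trans le_v).
have lfd_ok := @lfd_from_ok U k ev [::] I [::] k0 LFD isT (leq0n k).
have := avg_vcost_le k0 R (Bc := 0) (B := 0) sp lfd_ok isT (leq0n k) v0
  (leq0n _) (leq0n _) (leq0n _).
rewrite /avg /= big_seq1 invr1 mul1r mul0r mulr0 !addr0 => /le_trans; apply.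
rewrite -!addrA lerD2r ler_nat.
have := @lfd_from_optimal U k ev [::] I [::] [::] cs 0 k0 LFD isT (leq0n k)
  isT (leq0n k) cs_ok (fun _ _ => leqnn _).
by rewrite addn0.
Qed.
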